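(* For all integers $r\ge 1$ and $s\ge 2$, $\chi_{ltna}(rK_2\vee W_{2s})=5$.
   Context: All graphs are finite and simple. $rK_2$ is the disjoint union of $r$ copies of $K_2$. $W_{2s}$ is the wheel of order $2s+1$: $V(W_{2s})=\{v_j\mid 1\le j\le 2s+1\}$ and $E(W_{2s})=\{v_1v_{2s}\}\cup\{v_jv_{j+1}\mid 1\le j\le 2s-1\}\cup\{v_jv_{2s+1}\mid 1\le j\le 2s\}$. The join $G\vee H$ of (vertex-disjoint) graphs has $V(G\vee H)=V(G)\cup V(H)$ and $E(G\vee H)=E(G)\cup E(H)\cup\{uv\mid u\in V(G),v\in V(H)\}$. For a graph $G=(V,E)$ of order $p$ and size $q$ without isolated vertices, a bijection $f:V\cup E\to\{1,\dots,p+q\}$ is a local total neighborhood antimagic labeling of $G$ if the induced vertex coloring $f^+_{tn}(u)=\sum_{ux\in E}[f(ux)+f(x)]$ satisfies $f^+_{tn}(u)\ne f^+_{tn}(v)$ for every edge $uv\in E$. The number of distinct induced colors is $c_{tn}(f)$. The local total neighborhood antimagic chromatic number $\chi_{ltna}(G)$ is the minimum of $c_{tn}(f)$ over all local total neighborhood antimagic labelings $f$ of $G$; an assertion $\chi_{ltna}(G)=k$ includes the assertion that $G$ admits such a labeling. *)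

(* Defs.v *)
From HB Require Import structures.
From mathcomp Require Import all_boot.
Set Implicit Arguments.
Unset Strict Implicit.
Unset Printing Implicit Defensive.

Record sgraph := SGraph {
  vertex :> finType;
  adj : rel vertex;
  adj_sym : symmetric adj;
  adj_irrefl : irreflexive adj
}.

(* The edge uv is represented by the vertex set [set u; v]. *)
Definition edges (G : sgraph) : {set {set G}} :=
  [set [set x; y] | x in G, y in G & adj x y].

Definition no_isolated (G : sgraph) : Prop :=
  forall u : G, exists v : G, adj u v.

(* A labeling of V(G) and E(G) is a function on G + {set G} considered only on
   [elements G]; its values at sets that are not edges are irrelevant. *)
Definition elements (G : sgraph) : pred (G + {set G}) :=
  fun z => match z with inl _ => true | inr e => e \in edges G end.

Definition label_bijection (G : sgraph) (f : G + {set G} -> nat) : Prop :=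
  let n := #|G| + #|edges G| in
  [/\ {in elements (G := G), forall z, 1 <= f z <= n},
      {in elements (G := G) &, injective f} &
      forall k, 1 <= k <= n -> exists2 z, z \in elements (G := G) & f z = k].

Definition tn_color (G : sgraph) (f : G + {set G} -> nat) (u : G) : nat :=
  \sum_(x : G | adj u x) (f (inr [set u; x]) + f (inl x)).

Definition ltna_labeling (G : sgraph) (f : G + {set G} -> nat) : Prop :=
  [/\ no_isolated G, label_bijection f &
      forall u v : G, adj u v -> tn_color f u <> tn_color f v].

Definition num_tn_colors (G : sgraph) (f : G + {set G} -> nat) : nat :=
  size (undup [seq tn_color f u | u : G]).

(* [chi_ltna_eq G k]: the minimum defining chi_ltna(G) exists and equals k. *)
Definition chi_ltna_eq (G : sgraph) (k : nat) : Prop :=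
  (exists2 f : G + {set G} -> nat, ltna_labeling f & num_tn_colors f = k) /\
  (forall f : G + {set G} -> nat, ltna_labeling f -> k <= num_tn_colors f).

(* r disjoint copies of K_2: (i, b) is the endpoint b of the i-th copy. *)
Definition copiesK2_adj (r : nat) : rel ('I_r * bool) :=
  fun x y => (x.1 == y.1) && (x.2 != y.2).

Lemma copiesK2_sym r : symmetric (@copiesK2_adj r).
Proof. by move=> x y; rewrite /copiesK2_adj eq_sym [x.2 == _]eq_sym. Qed.

Lemma copiesK2_irrefl r : irreflexive (@copiesK2_adj r).
Proof. by move=> x; rewrite /copiesK2_adj !eqxx. Qed.

Definition copiesK2 (r : nat) : sgraph :=
  SGraph (@copiesK2_sym r) (@copiesK2_irrefl r).

(* The listed edges v_a v_b (a < b) of W_{2s}, with 1-based indices a, b. *)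
Definition wheel_edge (s a b : nat) : bool :=
  [|| (a == 1) && (b == 2 * s),
      [&& 1 <= a, a <= 2 * s - 1 & b == a.+1] |
      [&& 1 <= a, a <= 2 * s & b == (2 * s).+1]].

(* The ordinal i stands for v_(i+1). *)
Definition wheel_adj (s : nat) : rel 'I_(2 * s).+1 :=
  fun i j => wheel_edge s i.+1 j.+1 || wheel_edge s j.+1 i.+1.

Lemma wheel_sym s : symmetric (@wheel_adj s).
Proof. by move=> i j; rewrite /wheel_adj orbC. Qed.

Lemma wheel_irrefl s : irreflexive (@wheel_adj s).
Proof.
move=> i; rewrite /wheel_adj orbb /wheel_edge; apply/negbTE.
rewrite !negb_or; apply/and3P; split; apply/negP.
- case/andP=> /eqP-> /eqP h.
  by move: (congr1 odd h); rewrite mul2n odd_double.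
- by case/and3P=> _ _ /eqP/(@n_Sn _).
- by case/and3P=> _ h /eqP h'; rewrite h' ltnn in h.
Qed.

Definition wheel (s : nat) : sgraph :=
  SGraph (@wheel_sym s) (@wheel_irrefl s).

Definition join_adj (G H : sgraph) : rel (G + H) :=
  fun x y => match x, y with
    | inl u, inl v => adj u v
    | inr u, inr v => adj u v
    | _, _ => true
    end.

Lemma join_sym (G H : sgraph) : symmetric (@join_adj G H).
Proof. by move=> [x|x] [y|y] //=; rewrite adj_sym. Qed.

Lemma join_irrefl (G H : sgraph) : irreflexive (@join_adj G H).
Proof. by move=> [x|x] /=; rewrite adj_irrefl. Qed.

Definition join (G H : sgraph) : sgraph :=
  SGraph (@join_sym G H) (@join_irrefl G H).

(* Main.v *)
(* The graph contains K_5, and adjacent vertices get distinct colors, so 5 colors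
   are needed. For the converse, write a_i, b_i for the ends of the i-th K_2 and h
   for the hub. A labeling is chosen whose coloring is constant on each of the
   classes {a_i}, {b_i}, {v_j : j odd}, {v_j : j even}, {h}. The edges a_i v_j and
   b_i v_j off the hub get complementary labels in 1, ..., 4rs, which makes the
   column sums constant, and the columns alternate in direction, which makes the
   row sums constant. The labels of a_i b_i, a_i h and b_i h increase by 1 with i
   while those of a_i and b_i decrease by 2, so these contributions balance as
   well. On the cycle, vertices and rim edges are labeled by arithmetic
   progressions and the spokes absorb the remaining slope; the wrap-around leaves
   a defect of s + 1 at v_1, cancelled by exchanging the labels of a_0 v_1 and
   a_0 h. Finally the first two class colors have the parity of r, the next two
   the opposite parity, and the color of h exceeds all the others. *)

Require Import Defs.
From mathcomp Require Import all_boot.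
From mathcomp Require Import fingroup perm zify.
Set Implicit Arguments.
Unset Strict Implicit.
Unset Printing Implicit Defensive.

(** * Label formulas on numerical indices *)

Section Labels.
Variables r s : nat.

(** Boustrophedon numbering of an [r] by [2 * s] matrix: column [j] holds [r] consecutive numbers,
    read downwards for even [j] and upwards for odd [j]. *)
Definition tlab (i j : nat) : nat := r * j + (if odd j then r.-1 - i else i).+1.

(* First labels of the blocks: after the [4 * (r * s)] labels of the matrix and
   [s] labels of rim edges come, in this order, the edges [a_i h]; the spokes and
   the hub; the edges [a_i b_i]; the edges [b_i h]; the vertices [a_i] and [b_i];
   the other [s] rim edges; the other vertices of the wheel. *)
Definition p0 := 4 * (r * s) + s + 1.
Definition g0 := 4 * (r * s) + s + r + 1.
Definition x0 := 4 * (r * s) + 3 * s + r + 2.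
Definition q0 := x0 + r.
Definition ab0 := x0 + 2 * r.
Definition m0 := x0 + 4 * r.
Definition w0 := m0 + s.
Definition num_labels := 4 * (r * s) + 6 * s + 5 * r + 1.

(* Indices are 0-based: [i < r] for the copies of [K_2], [false] for [a_i] and
   [true] for [b_i]; [j < 2 * s] stands for [v_(j+1)] and [j = 2 * s] is the hub. *)
Definition ablab (i : nat) (b : bool) : nat := ab0 + 2 * (r.-1 - i) + b.
Definition vlab (j : nat) : nat :=
  if j == 2 * s then g0.+1 else
  if odd j then w0 + (2 * s).-1 - j./2 else w0 + j./2.
Definition xlab (i : nat) : nat := x0 + i.
Definition mlab (i : nat) (b : bool) (j : nat) : nat :=
  if j == 2 * s then (if b then q0 else p0) + i
  else if b then tlab i j else (4 * (r * s)).+1 - tlab i j.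
(** Index [j] names the rim edge from v_(j+1) to its cyclic successor. The closing edge gets [s]
    more than the odd progression would give, since its successor v_1 carries [w0] where the vertex
    progression would continue with [w0 + s]. *)
Definition rimlab (j : nat) : nat :=
  if odd j then (if j.+1 == 2 * s then 4 * (r * s) + s
                 else 4 * (r * s) + s.-1 - j./2)
  else m0 + j./2.
(** The spoke at v_1 takes [g0] and the hub [g0.+1]. Trading these two would make the defect at v_1
    equal to [s], which the exchange by [s + 1] could not cancel. *)
Definition spokelab (j : nat) : nat :=
  if odd j then g0 + (2 * s).+1 - j else if j == 0 then g0 else g0 + j.+1.

(** * Ranges and injectivity of the labels *)

Lemma tlab_bound (i j : nat) : i < r -> j < 2 * s -> 0 < tlab i j <= 2 * (r * s).
Proof.
move=> hi hj; rewrite /tlab.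
have : r * j + r <= 2 * (r * s) by rewrite -mulnSr mulnCA leq_mul2l hj orbT.
by case: odd; lia.
Qed.

Lemma tlab_inj (i j i' j' : nat) : i < r -> i' < r ->
  tlab i j = tlab i' j' -> i = i' /\ j = j'.
Proof.
move=> hi hi'; rewrite /tlab => e.
pose c i j := if odd j then r.-1 - i else i.
have hc a b : a < r -> c a b < r by rewrite /c; case: odd; lia.
have e' : j * r + c i j = j' * r + c i' j' by rewrite /c; lia.
have r0 : 0 < r by lia.
(* The offset within a column is below [r], so division by [r] recovers the column. *)
have ej : j = j'.
  by move: (congr1 (divn^~ r) e'); rewrite /= !divnMDl // !divn_small ?addn0 ?hc.
split=> //; move: e'; rewrite ej /c; case: odd; lia.
Qed.

(** Index type for the elements of the graph: vertices, edges a_i b_i, edges from the K_2's to the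
    wheel, rim edges and spokes. Counting and injectivity are settled here, without unordered
    pairs. *)
Definition code : finType :=
  (('I_r * bool) + 'I_(2 * s).+1 + ('I_r + 'I_r * bool * 'I_(2 * s).+1)
   + ('I_(2 * s) + 'I_(2 * s)))%type.

Lemma card_code : #|{: code}| = num_labels.
Proof. rewrite /code !card_sum !card_prod card_bool !card_ord /num_labels; lia. Qed.

Definition lab (c : code) : nat :=
  match c with
  | inl (inl (inl p)) => ablab p.1 p.2
  | inl (inl (inr j)) => vlab j
  | inl (inr (inl i)) => xlab i
  | inl (inr (inr p)) => mlab p.1.1 p.1.2 p.2
  | inr (inl j) => rimlab j
  | inr (inr j) => spokelab j
  end.

Hypothesis s2 : 1 < s.

Lemma vlab_range j : j < (2 * s).+1 ->
  j = 2 * s /\ vlab j = g0.+1 \/ j < 2 * s /\ w0 <= vlab j < w0 + 2 * s.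
Proof.
rewrite /vlab => hj; case: eqP => [->|ne]; [by left|right].
have := odd_double_half j; case: (odd j) => /= hh; lia.
Qed.

Lemma rimlab_range j : j < 2 * s ->
  4 * (r * s) < rimlab j <= 4 * (r * s) + s \/ m0 <= rimlab j < m0 + s.
Proof.
rewrite /rimlab => hj; have := odd_double_half j; case: (odd j) => /= hh.
  by left; case: eqP; lia.
by right; lia.
Qed.

Lemma spokelab_range j : j < 2 * s ->
  g0 <= spokelab j < g0 + (2 * s).+1 /\ spokelab j <> g0.+1.
Proof.
rewrite /spokelab => hj; have := odd_double_half j.
case: (odd j) => /= hh; [|case: eqP]; lia.
Qed.

Lemma mlab_range i b j : i < r -> j < (2 * s).+1 ->
  0 < mlab i b j <= 4 * (r * s) \/ p0 <= mlab i b j < p0 + r \/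
  q0 <= mlab i b j < q0 + r.
Proof.
rewrite /mlab => hi hj; case: eqP => [_|ne]; first by case: b; lia.
have /(tlab_bound hi) : j < 2 * s by lia.
by case: b; lia.
Qed.

Lemma vlab_inj j j' : j < (2 * s).+1 -> j' < (2 * s).+1 ->
  vlab j = vlab j' -> j = j'.
Proof.
move=> hj hj'.
have := odd_double_half j; have := odd_double_half j'.
rewrite /vlab /g0 /w0 /m0 /x0.
by case: eqP; case: eqP; case: (odd j); case: (odd j'); lia.
Qed.

Lemma rimlab_inj j j' : j < 2 * s -> j' < 2 * s -> rimlab j = rimlab j' -> j = j'.
Proof.
move=> hj hj'.
have := odd_double_half j; have := odd_double_half j'.
rewrite /rimlab /g0 /w0 /m0 /x0.
by case: (odd j); case: (odd j'); rewrite /= ; try case: eqP; try case: eqP; lia.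
Qed.

Lemma spokelab_inj j j' : j < 2 * s -> j' < 2 * s ->
  spokelab j = spokelab j' -> j = j'.
Proof.
move=> hj hj'.
have := odd_double_half j; have := odd_double_half j'.
rewrite /spokelab /g0 /w0 /m0 /x0.
by case: (odd j); case: (odd j'); rewrite /= ; try case: eqP; try case: eqP; lia.
Qed.

Lemma mlab_inj i b j i' b' j' :
  i < r -> j < (2 * s).+1 -> i' < r -> j' < (2 * s).+1 ->
  mlab i b j = mlab i' b' j' -> [/\ i = i', b = b' & j = j'].
Proof.
move=> hi hj hi' hj'.
have B a c : a < r -> c < (2 * s).+1 -> c <> 2 * s -> 0 < tlab a c <= 2 * (r * s).
  by move=> ha hc nc; apply: tlab_bound => //; lia.
rewrite /mlab /p0 /q0 /x0; case: eqP => [->|/(B _ _ hi hj) h1];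
  case: eqP => [->|/(B _ _ hi' hj') h2].
- by case: b; case: b' => e; split=> //; lia.
- by case: b; case: b'; lia.
- by case: b; case: b'; lia.
case: b; case: b' => e; try lia.
  by have [-> ->] := tlab_inj hi hi' e.
have /(tlab_inj hi hi') [-> ->] // : tlab i j = tlab i' j' by lia.
Qed.

Lemma lab_range c : 1 <= lab c <= num_labels.
Proof.
rewrite /num_labels; case: c => [[[[i b]|j]|[i|[[i b] j]]]|[j|j]] /=.
- have := ltn_ord i; rewrite /ablab /ab0 /x0; case: b; lia.
- have := vlab_range (ltn_ord j); rewrite /w0 /m0 /g0 /x0; lia.
- have := ltn_ord i; rewrite /xlab /x0; lia.
- have := mlab_range b (ltn_ord i) (ltn_ord j); rewrite /p0 /q0 /x0; lia.
- have := rimlab_range (ltn_ord j); rewrite /m0 /x0; lia.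
- have := spokelab_range (ltn_ord j); rewrite /g0; lia.
Qed.

Definition block (c : code) : nat :=
  match c with
  | inl (inl (inl p)) => 0
  | inl (inl (inr j)) => 1
  | inl (inr (inl i)) => 2
  | inl (inr (inr p)) => 3
  | inr (inl j) => 4
  | inr (inr j) => 5
  end.

(** These label sets are pairwise disjoint, so a label determines its block and injectivity can be
    checked block by block. *)
Lemma lab_block c :
  match block c return Prop with
  | 0 => ab0 <= lab c < m0
  | 1 => lab c = g0.+1 \/ w0 <= lab c
  | 2 => x0 <= lab c < q0
  | 3 => lab c <= 4 * (r * s) \/ p0 <= lab c < g0 \/ q0 <= lab c < ab0
  | 4 => 4 * (r * s) < lab c < p0 \/ m0 <= lab c < w0
  | _ => g0 <= lab c < x0 /\ lab c <> g0.+1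
  end.
Proof.
case: c => [[[[i b]|j]|[i|[[i b] j]]]|[j|j]] /=.
- have := ltn_ord i; rewrite /ablab /ab0 /m0 /x0; case: b; lia.
- have := vlab_range (ltn_ord j); lia.
- have := ltn_ord i; rewrite /xlab /q0; lia.
- have := mlab_range b (ltn_ord i) (ltn_ord j); rewrite /g0 /p0 /ab0 /q0 /x0; lia.
- have := rimlab_range (ltn_ord j); rewrite /p0 /w0 /m0 /x0; lia.
- have := spokelab_range (ltn_ord j); rewrite /g0 /x0; lia.
Qed.

Lemma lab_inj : injective lab.
Proof.
move=> c c' e.
have eb : block c = block c'.
  have := lab_block c; have := lab_block c'; rewrite -e.
  rewrite /w0 /m0 /ab0 /q0 /x0 /g0 /p0.
  by case: c {e} => [[[?|?]|[?|?]]|[?|?]]; case: c' => [[[?|?]|[?|?]]|[?|?]] //=; lia.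
move: c c' e eb => [[[[i b]|j]|[i|[[i b] j]]]|[j|j]] [[[[i' b']|j']|[i'|[[i' b'] j']]]|[j'|j']] //= e _.
- have [ei ->] : i = i' :> nat /\ b = b'.
    have := ltn_ord i; have := ltn_ord i'; move: e.
    by rewrite /ablab; case: b; case: b' => /=; lia.
  by rewrite (val_inj ei).
- by rewrite (val_inj (vlab_inj (ltn_ord _) (ltn_ord _) e)).
- by do 3 f_equal; apply/val_inj/(addnI e).
- have [ei -> ej] := mlab_inj (ltn_ord _) (ltn_ord _) (ltn_ord _) (ltn_ord _) e.
  by rewrite (val_inj ei) (val_inj ej).
- by rewrite (val_inj (rimlab_inj (ltn_ord _) (ltn_ord _) e)).
- by rewrite (val_inj (spokelab_inj (ltn_ord _) (ltn_ord _) e)).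
Qed.

Lemma lab_surj k : 1 <= k <= num_labels -> exists c, lab c = k.
Proof.
move=> hk.
have: k \in codom lab.
  have sub : {subset codom lab <= iota 1 num_labels}.
    by move=> _ /codomP[c ->]; rewrite mem_iota; have := lab_range c; lia.
  have u : uniq (codom lab) by rewrite map_inj_uniq ?enum_uniq //; exact: lab_inj.
  (* There are as many codes as admissible labels, so the inclusion of the image is an equality. *)
  have [|_ ->] := uniq_min_size u sub; first by rewrite size_codom card_code size_iota.
  by rewrite mem_iota; lia.
by case/codomP=> c ->; exists c.
Qed.


(** * Sums of labels over rows, the rim and the blocks *)

Lemma sum_double n (F : nat -> nat) :
  \sum_(j < 2 * n) F j = \sum_(k < n) (F (2 * k) + F (2 * k).+1).
Proof.
elim: n => [|n IH]; first by rewrite muln0 !big_ord0.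
by rewrite mulnS !big_ord_recr /= IH addnA.
Qed.

Lemma sum_tlab i : i < r -> \sum_(j < 2 * s) tlab i j = s + 2 * (r * (s * s)).
Proof.
move=> hi; rewrite sum_double.
(* In columns [2 * k] and [2 * k + 1] the offsets [i] and [r.-1 - i] add up to a constant. *)
rewrite (eq_bigr (fun k : 'I_s => 4 * (r * k) + 2 * r + 1)); last first.
  by move=> k _; rewrite /tlab /= oddM /=; lia.
elim: (s) => [|n IH]; first by rewrite big_ord0; lia.
by rewrite big_ord_recr /= IH; lia.
Qed.

Lemma sum_mlab i b : i < r -> \sum_(j < (2 * s).+1) mlab i b j =
  if b then q0 + i + s + 2 * (r * (s * s)) else p0 + i + s + 6 * (r * (s * s)).
Proof.
move=> hi; rewrite big_ord_recr /= {2}/mlab eqxx.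
have lt (j : 'I_(2 * s)) : (j == 2 * s :> nat) = false by have := ltn_ord j; lia.
have T := sum_tlab hi.
rewrite /mlab; under eq_bigr do rewrite lt.
case: b; first by rewrite T; lia.
(* Adding the complementary row back avoids summing truncated differences. *)
have : \sum_(j < 2 * s) ((4 * (r * s)).+1 - tlab i j) + \sum_(j < 2 * s) tlab i j
     = 2 * s * (4 * (r * s)).+1.
  rewrite -big_split /= (eq_bigr (fun=> (4 * (r * s)).+1)) ?sum_nat_const ?card_ord //.
  by move=> j _; have := tlab_bound hi (ltn_ord j); lia.
by rewrite T /=; nia.
Qed.

Definition prv j := if j == 0 then (2 * s).-1 else j.-1.
Definition nxt j := if j == (2 * s).-1 then 0 else j.+1.

(* The term [(j == 0) * s.+1] is the wrap-around defect of the cycle, restored by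
   the exchange [sw] below. *)
Lemma rim_sum j : j < 2 * s ->
  rimlab (prv j) + vlab (prv j) + (rimlab j + vlab (nxt j)) + spokelab j
    + (j == 0) * s.+1 =
  m0 + 2 * w0 + 4 * (r * s) + g0 + (if odd j then 3 * s else 5 * s).
Proof.
move=> hj.
have := odd_double_half j; case oj: (odd j) => /= hh.
  have -> : prv j = j./2.*2 by rewrite /prv; case: eqP; lia.
  rewrite /rimlab /vlab /spokelab oj odd_double doubleK -[X in X == 0]hh /=.
  (* The last rim vertex is followed by v_1, across the closing edge. *)
  case: (j.+1 =P 2 * s) => ej.
    have -> : nxt j = 0 by rewrite /nxt; case: eqP; lia.
    by rewrite /= !ifF; lia.
  have -> : nxt j = j.+1 by rewrite /nxt; case: eqP; lia.
  rewrite /= oj /= !ifF; [|lia..].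
  have -> : uphalf j = j./2.+1 by lia.
  by lia.
case: (posnP j) => [->|j0].
  have -> : prv 0 = (2 * s).-1 by [].
  have -> : nxt 0 = 1 by rewrite /nxt; case: eqP; lia.
  have o : odd (2 * s).-1 by lia.
  have h : (2 * s).-1./2 = s.-1 by lia.
  by rewrite /rimlab /vlab /spokelab o h /=; do 3 (case: eqP => ?); lia.
have -> : nxt j = j.+1 by rewrite /nxt; case: eqP; lia.
have [k ek] : exists k, j = k.+1.*2 by exists j./2.-1; lia.
have -> : prv j = k.*2.+1 by rewrite /prv; case: eqP; lia.
rewrite /rimlab /vlab /spokelab ek /= !odd_double /= !doubleK !uphalf_double.
by rewrite !ifF; lia.
Qed.

Lemma sum_eq0 n : 0 < n -> \sum_(i < n) (i == 0 :> nat) = 1.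
Proof. by case: n => // n _; rewrite big_ord_recl /= big1. Qed.

(** Spokes [2 * k] and [2 * k + 1] add up to [2 * g0 + 2 * s + 1], except that the pair [k = 0] is
    short by 1. *)
Lemma sum_spokelab : \sum_(j < 2 * s) spokelab j + 1 = s * (2 * g0 + 2 * s + 1).
Proof.
have s0 : 0 < s by lia.
rewrite sum_double -[X in _ + X = _](sum_eq0 s0) -big_split /= (eq_bigr (fun=> 2 * g0 + 2 * s + 1)).
  by rewrite sum_nat_const card_ord.
move=> k _; have := ltn_ord k; rewrite /spokelab /= !oddM /=.
by case: (k =P 0 :> nat) => [->|] //=; [|case: eqP]; lia.
Qed.

Lemma sum_vlab : \sum_(j < 2 * s) vlab j = s * (2 * (w0 + s.-1) + 1).
Proof.
rewrite sum_double (eq_bigr (fun=> 2 * (w0 + s.-1) + 1)).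
  by rewrite sum_nat_const card_ord.
move=> k _; have := ltn_ord k; rewrite /vlab /= !oddM /=.
do 2 (case: eqP => ?); lia.
Qed.

Lemma sum_ablab :
  \sum_(i < r) (ablab i true + ablab i false) = r * (2 * (ab0 + r.-1) + 1).
Proof.
(* Reversing the order turns [r.-1 - i] into [i]. *)
rewrite (reindex_inj rev_ord_inj) /=.
rewrite (eq_bigr (fun i : 'I_r => 2 * ab0 + 1 + 4 * i)); last first.
  by move=> i _; have := ltn_ord i; rewrite /ablab; lia.
elim: (r) => [|n IH]; first by rewrite big_ord0.
by rewrite big_ord_recr /= IH; case: n {IH} => [|n]; lia.
Qed.

End Labels.

(** * Unordered pairs and the clique bound *)

Lemma set2_eq (T : finType) (x y u v : T) :
  [set x; y] = [set u; v] -> x = u /\ y = v \/ x = v /\ y = u.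
Proof.
move=> e.
have : x \in [set u; v] by rewrite -e set21.
have : y \in [set u; v] by rewrite -e set22.
have : u \in [set x; y] by rewrite e set21.
have : v \in [set x; y] by rewrite e set22.
by rewrite !inE => /orP[]/eqP ? /orP[]/eqP ? /orP[]/eqP ? /orP[]/eqP ?; subst; auto.
Qed.

Lemma clique_num_colors (G : sgraph) (f : G + {set G} -> nat) (us : seq G) :
  ltna_labeling f -> pairwise (@adj G) us -> size us <= num_tn_colors f.
Proof.
case=> _ _ proper clq; rewrite -(size_map (tn_color f)) uniq_leq_size //.
  rewrite uniq_pairwise pairwise_map.
  by apply: sub_pairwise clq => u v /proper/eqP.
by move=> _ /mapP[u _ ->]; rewrite mem_undup map_f // mem_enum.
Qed.

(** * Transfer of the labels to the graph *)

Section Graph.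
Variables r s : nat.
Hypotheses (hr : 1 <= r) (hs : 2 <= s).

Let G := join (copiesK2 r) (wheel s).

(* The labels [mlab] of the edges from [(0, false)] to [v_1] and to the hub are
   exchanged: they differ by [s + 1], and the sum over the row is unchanged. *)
Definition sw (i : 'I_r) (b : bool) : {perm 'I_(2 * s).+1} :=
  if (i == 0 :> nat) && ~~ b then tperm ord0 ord_max else 1%g.

(** Meant for [a < b]: a rim edge is named by its smaller end, but the closing edge by its larger
    one. *)
Definition rim2 (a b : nat) : nat :=
  if b == 2 * s then spokelab r s a
  else if (a == 0) && (b == (2 * s).-1) then rimlab r s b else rimlab r s a.

Definition elab (x y : G) : nat :=
  match x, y with
  | inl p, inl _ => xlab r s p.1
  | inl p, inr j | inr j, inl p => mlab r s p.1 p.2 (sw p.1 p.2 j)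
  | inr j, inr j' => rim2 (minn j j') (maxn j j')
  end.

(** By [elab_sym] the orientation returned by [pick] does not affect the label; 0 is a default off
    the edges. *)
Definition flab (z : G + {set G}) : nat :=
  match z with
  | inl (inl p) => ablab r s p.1 p.2
  | inl (inr j) => vlab r s j
  | inr e => if [pick p : G * G | adj p.1 p.2 && (e == [set p.1; p.2])] is Some p
             then elab p.1 p.2 else 0
  end.

Lemma elab_sym (x y : G) : adj x y -> elab x y = elab y x.
Proof.
case: x y => [p|j] [q|j'] //=; last by rewrite minnC maxnC.
by case/andP=> /eqP->.
Qed.

Lemma flab_edge (x y : G) : adj x y -> flab (inr [set x; y]) = elab x y.
Proof.
move=> h /=; case: pickP => [[u v] /= /andP[huv /eqP/set2_eq[] [-> ->]] //|/(_ (x, y))/negP[]].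
  exact: elab_sym.
by apply/andP.
Qed.

Definition nxto (j : 'I_(2 * s).+1) : 'I_(2 * s).+1 := inord (nxt s j).
Definition prvo (j : 'I_(2 * s).+1) : 'I_(2 * s).+1 := inord (prv s j).
Definition wid (j : 'I_(2 * s)) : 'I_(2 * s).+1 := widen_ord (leqnSn _) j.

(** The column passes through [sw] here and once more in [elab]; since [sw] is an involution, the
    label read off is that of the code. *)
Definition elt (c : code r s) : G + {set G} :=
  match c with
  | inl (inl (inl p)) => inl (inl p)
  | inl (inl (inr j)) => inl (inr j)
  | inl (inr (inl i)) => inr [set (inl (i, false) : G); (inl (i, true) : G)]
  | inl (inr (inr p)) => inr [set (inl p.1 : G); (inr (sw p.1.1 p.1.2 p.2) : G)]
  | inr (inl j) => inr [set (inr (wid j) : G); (inr (nxto (wid j)) : G)]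
  | inr (inr j) => inr [set (inr (wid j) : G); (inr ord_max : G)]
  end.

Lemma swK i b : involutive (sw i b).
Proof. by move=> j; rewrite /sw; case: ifP => _; rewrite ?tpermK ?perm1. Qed.

Lemma nxtoE (j : 'I_(2 * s).+1) : j < 2 * s -> nxto j = nxt s j :> nat.
Proof. by move=> hj; rewrite inordK // /nxt; case: eqP; lia. Qed.

Lemma prvoE (j : 'I_(2 * s).+1) : j < 2 * s -> prvo j = prv s j :> nat.
Proof. by move=> hj; rewrite inordK // /prv; case: eqP; lia. Qed.

Lemma wheel_adjE (i j : 'I_(2 * s).+1) : i < 2 * s ->
  adj (i : wheel s) (j : wheel s) =
  [|| j == prvo i, j == nxto i | j == ord_max].
Proof.
move=> hi; have hj := ltn_ord j.
rewrite -!val_eqE /= prvoE ?nxtoE // /wheel_adj /wheel_edge /prv /nxt.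
case: (nat_of_ord i =P 0) => ?; case: (nat_of_ord i =P _.-1) => ?; lia.
Qed.

Lemma wheel_adj_max (j : 'I_(2 * s).+1) :
  adj (ord_max : wheel s) (j : wheel s) = (j < 2 * s).
Proof.
have hj := ltn_ord j; rewrite /= /wheel_adj /wheel_edge /=; lia.
Qed.

Lemma rim2_nxt j : j < 2 * s -> rim2 (minn j (nxt s j)) (maxn j (nxt s j)) = rimlab r s j.
Proof.
move=> hj; rewrite /rim2 /nxt; case: (j =P (2 * s).-1) => [->|ne].
  by rewrite minn0 maxn0 ifF ?eqxx //; lia.
rewrite (minn_idPl _) ?(maxn_idPr _) //.
case: eqP => e; first by lia.
by rewrite ifF //; lia.
Qed.

Lemma rim2_prv j : j < 2 * s -> rim2 (minn j (prv s j)) (maxn j (prv s j)) = rimlab r s (prv s j).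
Proof.
move=> hj; have hp : prv s j < 2 * s by rewrite /prv; case: eqP; lia.
rewrite -(rim2_nxt hp) minnC maxnC; congr (rim2 (minn _ _) (maxn _ _));
  by rewrite /nxt /prv; do 2 case: eqP; lia.
Qed.

Lemma elt_elements c : elt c \in elements (G := G).
Proof.
have E (x y : G) : adj x y -> inr [set x; y] \in elements (G := G).
  by move=> h; rewrite unfold_in /=; apply/imset2P; exists x y; rewrite // inE.
case: c => [[[p|j]|[i|p]]|[j|j]] //=; apply: E => //=.
- by rewrite /copiesK2_adj /= eqxx.
- have hj : wid j < 2 * s := ltn_ord j.
  by have := wheel_adjE (nxto (wid j)) hj; rewrite eqxx /= orbT.
- have hj : wid j < 2 * s := ltn_ord j.
  by have := wheel_adjE ord_max hj; rewrite eqxx !orbT.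
Qed.

Lemma flab_elt c : flab (elt c) = lab c.
Proof.
case: c => [[[p|j]|[i|p]]|[j|j]] //; rewrite [elt _]/= flab_edge //=.
- by rewrite /copiesK2_adj /= eqxx.
- by rewrite swK.
- by rewrite nxtoE ?rim2_nxt //= ltn_ord.
- have hj : wid j < 2 * s := ltn_ord j.
  by have := wheel_adjE (nxto (wid j)) hj; rewrite eqxx /= orbT.
- have hj := ltn_ord j.
  by rewrite (minn_idPl _) ?(maxn_idPr _) /rim2 ?eqxx //; exact: ltnW.
- have hj : wid j < 2 * s := ltn_ord j.
  by have := wheel_adjE ord_max hj; rewrite eqxx !orbT.
Qed.

Lemma wheel_edge_elt (i j : 'I_(2 * s).+1) : i < 2 * s ->
  adj (i : wheel s) (j : wheel s) ->
  exists c, elt c = inr [set (inr i : G); (inr j : G)].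
Proof.
move=> hi; rewrite wheel_adjE //.
have ei : wid (Ordinal hi) = i by exact: val_inj.
case/or3P=> /eqP->.
- have hp : prvo i < 2 * s by rewrite prvoE // /prv; case: eqP; lia.
  exists (inr (inl (Ordinal hp))) => /=.
  have -> : wid (Ordinal hp) = prvo i by exact: val_inj.
  have -> : nxto (prvo i) = i.
    by apply: val_inj; rewrite /= nxtoE // prvoE // /nxt /prv; do 2 case: eqP; lia.
  by rewrite setUC.
- by exists (inr (inl (Ordinal hi))) => /=; rewrite ei.
- by exists (inr (inr (Ordinal hi))) => /=; rewrite ei.
Qed.

Lemma elt_surj z : z \in elements (G := G) -> exists c, elt c = z.
Proof.
case: z => [[p|j]|e]; first by exists (inl (inl (inl p))).
  by exists (inl (inl (inr j))).
rewrite unfold_in /= => /imset2P[x y _]; rewrite inE => /= h ->.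
case: x y h => [[i b]|j] [[i' b']|j'] h.
- case/andP: h => /= /eqP <- h; exists (inl (inr (inl i))) => /=.
  by case: b b' h => [] [] //= _; rewrite setUC.
- by exists (inl (inr (inr (i, b, sw i b j')))); rewrite /= swK.
- by exists (inl (inr (inr (i', b', sw i' b' j)))); rewrite /= swK setUC.
case: (ltnP j (2 * s)) => hj; first exact: wheel_edge_elt.
have ej : j = ord_max by apply: val_inj => /=; have := ltn_ord j; lia.
have hj' : j' < 2 * s by rewrite -wheel_adj_max -ej; exact: h.
by rewrite setUC; apply: wheel_edge_elt => //; rewrite wheel_adjE // ej eqxx !orbT.
Qed.

(** [elt] transports the bijection [lab]: it reaches every element, and it is injective because the
    labels already separate its values. *)
Lemma flab_bijection : label_bijection flab.
Proof.
have linj := @lab_inj r s hs.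
have einj : injective elt by move=> c c' e; apply: linj; rewrite -!flab_elt e.
have eN : #|G| + #|edges G| = num_labels r s.
  rewrite -(card_code r s) -(card_imset _ einj).
  have -> : elt @: code r s = [set z in elements (G := G)].
    apply/setP=> z; rewrite inE; apply/imsetP/idP => [[c _ ->]|/elt_surj[c <-]].
      exact: elt_elements.
    by exists c.
  rewrite cardsE -[RHS]sum1_card big_sumType /= !sum1_card.
  by congr (_ + _); apply: eq_card.
rewrite /label_bijection eN; split.
- by move=> z /elt_surj[c <-]; rewrite flab_elt; exact: lab_range.
- by move=> z z' /elt_surj[c <-] /elt_surj[c' <-]; rewrite !flab_elt => /linj->.
- move=> k /(lab_surj hs)[c ec]; exists (elt c); last by rewrite flab_elt.
  exact: elt_elements.
Qed.


(** * The induced colors *)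

Lemma tn_color_flab (u : G) :
  tn_color flab u = \sum_(x : G | adj u x) (elab u x + flab (inl x)).
Proof. by apply: eq_bigr => x h; rewrite flab_edge. Qed.

Lemma sum_wheel_vlab :
  \sum_(j < (2 * s).+1) vlab r s j = s * (2 * (w0 r s + s.-1) + 1) + (g0 r s).+1.
Proof. by rewrite big_ord_recr /= sum_vlab // {1}/vlab eqxx. Qed.

(** The edge to the other end and the hub edge contribute [i] each, the label of the other end
    [- 2 * i]. The [+ 1] for a_i arises because b_i is labeled one higher than a_i. *)
Lemma color_copies (i : 'I_r) (b : bool) :
  tn_color flab (inl (i, b)) =
  x0 r s + ab0 r s + 2 * r.-1
  + (if b then q0 r s + s + 2 * (r * (s * s))
     else p0 r s + s + 6 * (r * (s * s)) + 1)
  + s * (2 * (w0 r s + s.-1) + 1) + (g0 r s).+1.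
Proof.
rewrite tn_color_flab big_sumType /=.
rewrite (big_pred1 (i, ~~ b)); last first.
  move=> [i' b']; rewrite /= /copiesK2_adj /= xpair_eqE eq_sym.
  by case: b b' => [] [].
rewrite big_split /= sum_wheel_vlab (reindex_inj (@perm_inj _ (sw i b))) /=.
under eq_bigr => j _ do rewrite swK.
rewrite sum_mlab //.
have := ltn_ord i; rewrite /xlab /ablab; case: b => /=; lia.
Qed.

Lemma sum_copies (F : 'I_r * bool -> nat) :
  \sum_p F p = \sum_i (F (i, true) + F (i, false)).
Proof.
rewrite (eq_bigr (fun p => F (p.1, p.2))); last by case.
rewrite -(pair_bigA _ (fun i b => F (i, b))) /=.
by apply: eq_bigr => i _; rewrite big_bool.
Qed.

Lemma column_sum (j : 'I_(2 * s).+1) : j < 2 * s ->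
  \sum_(p : 'I_r * bool) (mlab r s p.1 p.2 (sw p.1 p.2 j) + ablab r s p.1 p.2) =
  r * (4 * (r * s)).+1 + (j == 0 :> nat) * s.+1
  + r * (2 * (ab0 r s + r.-1) + 1).
Proof.
move=> hj; rewrite big_split /= !sum_copies /= sum_ablab //; congr (_ + _).
(* The correction is spread as a sum supported at [i = 0], so that both sides can be compared copy
   by copy. *)
have -> : (j == 0 :> nat) * s.+1 = \sum_(i < r) (i == 0 :> nat) * ((j == 0 :> nat) * s.+1).
  by rewrite -big_distrl /= sum_eq0 // mul1n.
have -> : r * (4 * (r * s)).+1 = \sum_(i < r) (4 * (r * s)).+1.
  by rewrite sum_nat_const card_ord.
rewrite -big_split /=; apply: eq_bigr => i _; rewrite /sw andbF perm1 andbT.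
have nj : (j == 2 * s :> nat) = false by lia.
have hi := ltn_ord i.
case: (i =P 0 :> nat) => [i0|ni]; last first.
  rewrite perm1 /mlab nj; have := tlab_bound hi hj; lia.
case: (j =P ord0) => [j0|/eqP ne].
  rewrite j0 tpermL /mlab /= eqxx /p0 /= i0 /tlab /= muln0.
  have -> : (0 == 2 * s) = false by lia.
  by rewrite /=; lia.
have nj0 : (j == 0 :> nat) = false by apply: negbTE.
rewrite tpermD; first last.
- by rewrite -val_eqE /= eq_sym nj.
- by rewrite eq_sym.
rewrite nj0 /mlab nj; have := tlab_bound hi hj; lia.
Qed.

Lemma color_rim (j : 'I_(2 * s).+1) : j < 2 * s ->
  tn_color flab (inr j) =
  r * (4 * (r * s)).+1 + r * (2 * (ab0 r s + r.-1) + 1)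
  + (g0 r s).+1 + (m0 r s + 2 * w0 r s + 4 * (r * s) + g0 r s)
  + (if odd j then 3 * s else 5 * s).
Proof.
move=> hj; rewrite tn_color_flab big_sumType /= column_sum //.
have ep := prvoE hj; have en := nxtoE hj.
rewrite (bigD1 (prvo j)) /=; last first.
  by have := wheel_adjE (prvo j) hj; rewrite eqxx.
rewrite (bigD1 (nxto j)) /=; last first.
  have := wheel_adjE (nxto j) hj; rewrite eqxx orbT /= => ->.
  rewrite -val_eqE /= ep en /nxt /prv.
  by case: (nat_of_ord j =P 0); case: (nat_of_ord j =P _.-1); lia.
rewrite (big_pred1 ord_max) /=; last first.
  move=> x; have := wheel_adjE x hj; rewrite /= => ->.
  rewrite -!val_eqE /= ep en.
  by rewrite /nxt /prv; case: (nat_of_ord j =P 0); case: (nat_of_ord j =P _.-1); lia.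
rewrite ep en rim2_prv // rim2_nxt //.
rewrite (minn_idPl _) ?(maxn_idPr _) /rim2 ?eqxx; [|lia..].
have := rim_sum r hs hj; rewrite [vlab r s (2 * s)]/vlab eqxx; lia.
Qed.

(** Of the deficit [s + 2], the exchange at a_0 h accounts for [s + 1] and the spoke at v_1 for
    1. *)
Lemma color_hub :
  tn_color flab (inr ord_max) + s + 2 =
  r * (p0 r s + q0 r s + r.-1)
  + r * (2 * (ab0 r s + r.-1) + 1)
  + s * (2 * g0 r s + 2 * s + 1) + s * (2 * (w0 r s + s.-1) + 1).
Proof.
rewrite tn_color_flab big_sumType /=.
rewrite (eq_bigl (fun x : 'I_(2 * s).+1 => x < 2 * s)); last exact: wheel_adj_max.
rewrite [X in _ + X + s]big_mkcond big_ord_recr /= ltnn addn0.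
rewrite (eq_bigr (fun j : 'I_(2 * s) => spokelab r s j + vlab r s j)); last first.
  move=> j _; have hj := ltn_ord j.
  by rewrite hj (minn_idPr _) ?(maxn_idPl _) /rim2 ?eqxx; [|lia..].
rewrite big_split [X in _ + X + s]big_split /= -sum_spokelab // -sum_vlab // -sum_ablab //.
rewrite !sum_copies /=.
have -> : r * (p0 r s + q0 r s + r.-1) = \sum_(i < r) (p0 r s + q0 r s + 2 * i).
  elim: (r) (p0 r s + q0 r s) => [|n IH] c; first by rewrite big_ord0.
  by rewrite big_ord_recr /= -IH; case: n {IH} => [|n]; lia.
set A := \sum_(i < r) (ablab r s i true + _).
set M := \sum_(i < r) (mlab r s i true _ + _).
set P := \sum_(i < r) (p0 r s + _ + _).
set S := \sum_(i < 2 * s) spokelab r s i; set V := \sum_(i < 2 * s) vlab r s i.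
suff: M + s.+1 = P by lia.
rewrite {}/M {}/P.
have -> : s.+1 = \sum_(i < r) (i == 0 :> nat) * s.+1.
  by rewrite -big_distrl /= sum_eq0 // mul1n.
rewrite -big_split /=.
apply: eq_bigr => i _; rewrite /sw andbF perm1 andbT {1}/mlab /= eqxx.
have n0 : (0 == 2 * s) = false by lia.
case: (i =P 0 :> nat) => [->|_].
  by rewrite tpermR /mlab /= n0 /p0 /tlab /=; lia.
by rewrite perm1 /mlab /= eqxx; lia.
Qed.

(** * The five colors are distinct *)

Definition colK (b : bool) : nat :=
  x0 r s + ab0 r s + 2 * r.-1
  + (if b then q0 r s + s + 2 * (r * (s * s))
     else p0 r s + s + 6 * (r * (s * s)) + 1)
  + s * (2 * (w0 r s + s.-1) + 1) + (g0 r s).+1.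

Definition colR (o : bool) : nat :=
  r * (4 * (r * s)).+1 + r * (2 * (ab0 r s + r.-1) + 1)
  + (g0 r s).+1 + (m0 r s + 2 * w0 r s + 4 * (r * s) + g0 r s)
  + (if o then 3 * s else 5 * s).

Lemma odd_colK b : odd (colK b) = odd r.
Proof.
rewrite /colK /w0 /m0 /ab0 /q0 /x0 /g0 /p0.
by case: b; do 2 rewrite /= ?(oddD, oddM) /=; case: (odd r); case: (odd s).
Qed.

Lemma odd_colR o : odd (colR o) = ~~ odd r.
Proof.
rewrite /colR /w0 /m0 /ab0 /q0 /x0 /g0 /p0.
by case: o; do 2 rewrite /= ?(oddD, oddM) /=; case: (odd r); case: (odd s).
Qed.

Lemma colK_neq_colR b o : colK b != colR o.
Proof.
apply/eqP => e; have := odd_colR o; rewrite -e odd_colK.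
by case: (odd r).
Qed.

Lemma colK_lt : colK true < colK false.
Proof.
rewrite /colK /w0 /m0 /ab0 /q0 /x0 /g0 /p0.
(* These substitutions build in the lower bounds on [r] and [s] and remove the truncated
   predecessors. *)
have [r' er] : exists r', r = r'.+1 by exists r.-1; lia.
have [s' es] : exists s', s = s'.+2 by exists s.-2; lia.
rewrite er es /=; nia.
Qed.

Lemma hub_gtK : colK false < tn_color flab (inr ord_max).
Proof.
have := color_hub; move: (tn_color _ _) => h.
rewrite /colK /w0 /m0 /ab0 /q0 /x0 /g0 /p0.
have [r' er] : exists r', r = r'.+1 by exists r.-1; lia.
have [s' es] : exists s', s = s'.+2 by exists s.-2; lia.
rewrite er es /=; nia.
Qed.

Lemma hub_gtR o : colR o < tn_color flab (inr ord_max).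
Proof.
have := color_hub; move: (tn_color _ _) => h.
rewrite /colR /w0 /m0 /ab0 /q0 /x0 /g0 /p0.
have [r' er] : exists r', r = r'.+1 by exists r.-1; lia.
have [s' es] : exists s', s = s'.+2 by exists s.-2; lia.
rewrite er es /=; case: o; nia.
Qed.

Definition colors : seq nat :=
  [:: colK true; colK false; colR true; colR false;
      tn_color flab (inr ord_max)].

(** Position of the color of [u] in [colors]. Indices are 0-based, so [odd j] selects the v's of
    even index. *)
Definition class (u : G) : nat :=
  match u with
  | inl p => ~~ p.2
  | inr j => if j == ord_max then 4 else if odd j then 2 else 3
  end.

Lemma uniq_colors : uniq colors.
Proof.
have h5 : colR true < colR false by rewrite /colR; lia.
move: colK_lt hub_gtK (hub_gtR true) (hub_gtR false) h5.
rewrite /= !inE !(negbTE (colK_neq_colR _ _)).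
move: (tn_color _ _) (colK true) (colK false) (colR true) (colR false) => *; lia.
Qed.

Lemma color_class (u : G) : tn_color flab u = nth 0 colors (class u).
Proof.
case: u => [[i b]|j]; first by rewrite color_copies /=; case: b.
rewrite /class; case: (j =P ord_max) => [->|/eqP ne] //.
have hj : j < 2 * s.
  by move: ne (ltn_ord j); rewrite -val_eqE /=; lia.
by rewrite color_rim //; case: odd.
Qed.

Lemma class_lt (u : G) : class u < 5.
Proof. by case: u => [[i []]|j] //=; case: ifP => // _; case: ifP. Qed.

(** The rim has even length, so parity alternates along it, also across the closing edge. *)
Lemma class_adj (u v : G) : adj u v -> class u != class v.
Proof.
case: u v => [[i b]|j] [[i' b']|j'] //=.
- by case/andP=> _; case: b; case: b'.
- by move=> _; case: b; case: ifP => // _; case: ifP.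
- by move=> _; case: b'; case: ifP => // _; case: ifP.
rewrite -!val_eqE /= /wheel_adj /wheel_edge.
have := ltn_ord j; have := ltn_ord j'.
case: (nat_of_ord j =P 2 * s) => ?; case: (nat_of_ord j' =P 2 * s) => ?;
  by case: (boolP (odd j)); case: (boolP (odd j')); lia.
Qed.

Lemma flab_labeling : ltna_labeling flab.
Proof.
split; first 1 last.
- exact: flab_bijection.
- move=> u v /class_adj; rewrite !color_class -(nth_uniq 0 _ _ uniq_colors) ?class_lt //.
  by move/eqP.
move=> [p|j]; first by exists (inr ord0).
by exists (inl (Ordinal hr, false)).
Qed.

(** * Exactly five colors *)

Lemma num_colors_ge (f : G + {set G} -> nat) : ltna_labeling f -> 5 <= num_tn_colors f.
Proof.
move=> hf.
have h2 : 2 < (2 * s).+1 by lia.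
pose i0 : 'I_r := Ordinal hr.
(* The K_5 formed by a_0, b_0, v_1, v_2 and the hub. *)
pose us : seq G := [:: inl (i0, false); inl (i0, true); inr ord0;
  inr (Ordinal (ltnW h2)); inr ord_max].
apply: (clique_num_colors (us := us)) => //=.
rewrite /copiesK2_adj /wheel_adj /wheel_edge /= eqxx; lia.
Qed.

Lemma num_colors_flab : num_tn_colors flab = 5.
Proof.
apply/eqP; rewrite eqn_leq num_colors_ge ?andbT; last exact: flab_labeling.
rewrite /num_tn_colors -[5]/(size colors) uniq_leq_size ?undup_uniq // => c.
by rewrite mem_undup => /mapP[u _ ->]; rewrite color_class mem_nth ?class_lt.
Qed.

End Graph.

Unset Implicit Arguments.

Theorem theorem2p6 (r s : nat) (hr : 1 <= r) (hs : 2 <= s) :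
  chi_ltna_eq (join (copiesK2 r) (wheel s)) 5.
Proof.
split; last exact: num_colors_ge.
by exists (@flab r s); [exact: flab_labeling | exact: num_colors_flab].
Qed.
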